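(* For every $u>0$, the optimal proportion of investment $t_u$ equals $\overline t_u$; that is, $\overline t_u$ is an optimal proportion of investment with respect to $u$, and it is the only one. Here $u\mapsto\overline t_u$ is the continuous function on $(0,+\infty)$ defined in the context.
   Context: Setting: $I\subseteq\mathbb R$ is an interval, $F$ is a probability distribution function on $I$, and $\int_I g(x)\,d(F(x))$ is the Lebesgue–Stieltjes integral with respect to the associated probability measure. $a:I\to\mathbb R$ is measurable, $\xi:=\inf_{x\in I}a(x)>-\infty$, and $\xi$ is the essential infimum of $a$: $\int_{a(x)<\xi+\varepsilon}d(F(x))>0$ for all $\varepsilon>0$. $a$ is not a.e. constant: $\int_{a(x)<\xi+\delta}d(F(x))<1$ for some $\delta>0$. $E:=\int_I a(x)\,d(F(x))$ is assumed to satisfy $0<E\le+\infty$. $H:=\int_I \frac1{a(x)}d(F(x))$ (used when $\xi\ge0$) and $H_\xi:=\int_I\frac1{a(x)-\xi}d(F(x))\in(0,+\infty]$, with $1/0=+\infty$ (so $H_\xi=+\infty$ if $\{a=\xi\}$ has positive measure; likewise for $H=H_0$ when $\xi=0$) and $1/(+\infty)=0$. Optimal proportion: for $u>0$, a number $t_u$ with $0\le t_u\le1$ and $\xi t_u/u-t_u+1\ge0$ is an optimal proportion of investment with respect to $u$ if $$\limsup_{\substack{\rho\to t_u\\ 0\le\rho\le1,\ \xi\rho/u-\rho+1>0}}\ \int_I\log\frac{a(x)t/u-t+1}{a(x)\rho/u-\rho+1}\,d(F(x))\le0$$ for every $t$ with $0\le t\le1$ and $\xi t/u-t+1>0$ (integrals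 being taken in the extended real sense). For $u>\max(0,\xi)$ and $0<t<u/(u-\xi)$ put $w_u(t):=\int_I\frac{a(x)-u}{a(x)t-ut+u}d(F(x))$. For $\max(0,\xi+1/H_\xi)<u<E$ the equation $w_u(t)=0$ has a unique solution in $(0,u/(u-\xi))$, denoted $\widetilde t_u$. For $u>0$, $\overline t_u$ is defined by: if $\xi\ge0$: $\overline t_u=1$ for $0<u\le 1/H$, $\overline t_u=\widetilde t_u$ for $1/H<u<E$, $\overline t_u=0$ for $u\ge E$; if $\xi<0$: $\overline t_u=\frac{u}{u-\xi}$ for $0<u\le\max(0,\xi+1/H_\xi)$, $\overline t_u=\widetilde t_u$ for $\max(0,\xi+1/H_\xi)<u<E$, $\overline t_u=0$ for $u\ge E$. *)

(* Defs.v *)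
From HB Require Import structures.
From mathcomp Require Import all_boot all_order all_algebra.
From mathcomp Require Import all_classical all_reals all_analysis.
Set Implicit Arguments.
Unset Strict Implicit.
Unset Printing Implicit Defensive.
Import Order.TTheory GRing.Theory Num.Theory.
Import numFieldNormedType.Exports.
Local Open Scope classical_set_scope.
Local Open Scope ring_scope.

Section optimal_proportion.
Context {R : realType}.

(* A distribution function F on the interval I is represented by a cumulative
   distribution function on the whole line whose Stieltjes measure gives I
   mass 1 (an endpoint of I may thus carry an atom).  The payoff a is only
   ever evaluated on I. *)
Variables (I : interval R) (F : cumulativeBounded (0 : R) (1 : R)) (a : R -> R).

Local Notation mu := (lebesgue_stieltjes_measure F).

Definition is_distribution_on : Prop := mu [set` I] = 1%E.

(* [inf] is the infimum in R; it is meaningful when a is bounded below on I. *)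
Definition xi : R := inf (a @` [set` I]).

Definition expectation_a : \bar R := (\int[mu]_(x in [set` I]) (a x)%:E)%E.

(* Inverses below are taken in \bar R, where 0^-1 = +oo and +oo^-1 = 0. *)
Definition H_at (c : R) : \bar R :=
  (\int[mu]_(x in [set` I]) ((a x - c)%:E)^-1)%E.

Definition H : \bar R := H_at 0.

Definition H_xi : \bar R := H_at xi.

(* For u > 0, xi * rho / u - rho + 1 > 0 and xi * t / u - t + 1 > 0, the
   argument of ln is positive at every x in I. *)
Definition log_ratio (u t rho : R) : \bar R :=
  (\int[mu]_(x in [set` I])
     (ln ((a x * t / u - t + 1) / (a x * rho / u - rho + 1)))%:E)%E.

Definition admissible (u : R) : set R :=
  [set t | 0 <= t <= 1 /\ 0 < xi * t / u - t + 1].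

(* The limsup is over the punctured neighbourhoods of t0 in [admissible u]. *)
Definition optimal_proportion (u t0 : R) : Prop :=
  [/\ 0 <= t0 <= 1, 0 <= xi * t0 / u - t0 + 1 &
    forall t, admissible u t ->
      (limf_esup (log_ratio u t) (within (admissible u) t0^') <= 0)%E].

Definition w (u t : R) : \bar R :=
  (\int[mu]_(x in [set` I]) ((a x - u) / (a x * t - u * t + u))%:E)%E.

(* The solution t of w u t = 0 in ]0, u / (u - xi)[; it exists and is unique
   when max(0, xi + 1 / H_xi) < u < E, which covers every use in [t_bar]
   because xi + 1 / H_xi <= 1 / H when 0 <= xi. *)
Definition t_tilde (u : R) : R :=
  xget 0 [set t | 0 < t < u / (u - xi) /\ w u t = 0%E].

Definition t_bar (u : R) : R :=
  if 0 <= xi then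
    if (u%:E <= H^-1)%E then 1
    else if (u%:E < expectation_a)%E then t_tilde u
    else 0
  else
    if (u%:E <= maxe 0 (xi%:E + H_xi^-1))%E then u / (u - xi)
    else if (u%:E < expectation_a)%E then t_tilde u
    else 0.

End optimal_proportion.

(* Main.v *)
(** Investing a proportion t of one's capital in the payoff a at price u
    multiplies it by p_t = a t/u - t + 1.  Everything is read off
    V u t = E[1/p_t], for which t w_u(t) = 1 - V u t and, p_t/p_r being affine
    in 1/p_r,
      E[log (p_t/p_r)] <= E[p_t/p_r] - 1 = (t/r - 1) (1 - V u r).
    As (1 - V u t)/t strictly decreases in t, there is exactly one t0 in [0, m],
    m the supremum of the admissible proportions, before which V u < 1 and
    after which V u > 1; the inequality above, used in both directions, makes
    t0 optimal and every other proportion non-optimal.  With c = min(xi, 0) one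
    has m = u/(u - c), the case t0 = 0 means E <= u, the case t0 = m means
    H_c <= 1/(u - c), and otherwise t0 is the zero of w_u.  Continuity of t0
    in u follows from that of V u t at fixed t, by comparing signs of V - 1. *)

Require Import Defs.
From HB Require Import structures.
From mathcomp Require Import all_boot all_order all_algebra.
From mathcomp Require Import all_classical all_reals all_analysis.
From mathcomp Require Import measurable_realfun ring lra.
Import Order.TTheory GRing.Theory Num.Theory.
Import numFieldNormedType.Exports.
Set Implicit Arguments.
Unset Strict Implicit.
Unset Printing Implicit Defensive.
Local Open Scope classical_set_scope.
Local Open Scope ring_scope.

(** * Integration over a set of mass one *)

Section probability_space.
Context d (T : measurableType d) (R : realType) (mu : {measure set T -> \bar R})
  (D : set T) (mD : measurable D) (D1 : mu D = 1%E).
Implicit Types (f g p q : T -> R).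

Lemma bounded_integrable f (M : R) : measurable_fun D f ->
  (forall x, D x -> `|f x| <= M) -> mu.-integrable D (EFin \o f).
Proof.
move=> mf fM; apply: measurable_bounded_integrable => //.
  by rewrite D1 ltry.
exists M; split; first by rewrite num_real.
by move=> M' /ltW MM' x Dx; exact: le_trans (fM _ Dx) MM'.
Qed.

Lemma integrable_cst (r : R) : mu.-integrable D (EFin \o cst r).
Proof.
by apply: (bounded_integrable (M := `|r|)) => //; exact: measurable_cst.
Qed.

Lemma integral_EFin f : mu.-integrable D (EFin \o f) ->
  (\int[mu]_(x in D) (f x)%:E)%E = (\int[mu]_(x in D) f x)%:E.
Proof. by move=> fi; rewrite /Rintegral fineK//; exact: integrable_fin_num. Qed.

Lemma Rintegral_affine f (r s : R) : mu.-integrable D (EFin \o f) ->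
  \int[mu]_(x in D) (r + s * f x) = r + s * \int[mu]_(x in D) f x.
Proof.
move=> fi.
rewrite RintegralD//.
- by rewrite Rintegral_cst// D1 mulr1 RintegralZl.
- exact: (integrable_cst r).
- by have := integrableZl mD s fi; apply: eq_integrable => // x _; rewrite /= EFinM.
Qed.

Lemma Rintegral_affine2 f g (r s k : R) :
  mu.-integrable D (EFin \o f) -> mu.-integrable D (EFin \o g) ->
  \int[mu]_(x in D) (r + s * f x + k * g x) =
  r + s * \int[mu]_(x in D) f x + k * \int[mu]_(x in D) g x.
Proof.
move=> fi gi.
have scale h l : mu.-integrable D (EFin \o h) -> mu.-integrable D (EFin \o (fun x => l * h x)).
  by move=> hi; have := integrableZl mD l hi; apply: eq_integrable => // x _; rewrite /= EFinM.
have cstr := integrable_cst r.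
rewrite RintegralD ?RintegralD ?RintegralZl//; last 2 first.
- by apply: (integrableD mD cstr (scale f s fi)).
- by exact: scale.
- by rewrite Rintegral_cst// D1 mulr1.
- by exact: scale.
Qed.

Lemma Rintegral_gt0 f : mu.-integrable D (EFin \o f) -> (forall x, D x -> 0 <= f x) ->
  ~ {ae mu, forall x, D x -> f x = 0} -> 0 < \int[mu]_(x in D) f x.
Proof.
move=> fi f0 nf0; rewrite lt_neqAle Rintegral_ge0// andbT eq_sym.
apply/eqP => If0; apply: nf0.
have /integrableP[mf _] := fi.
have [+ _] := ae_eq_integral_abs mu mD mf.
under eq_integral => x /[!inE] Dx do rewrite /= ger0_norm ?f0//.
rewrite integral_EFin// If0 => /(_ erefl).
by apply: filterS => x /[apply] -[].
Qed.

(* No integrability is needed because oo - oo = -oo in [\bar R]. *)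
Lemma le_integral_measurable (f g : T -> \bar R) : measurable_fun D f -> measurable_fun D g ->
  (forall x, D x -> (f x <= g x)%E) ->
  (\int[mu]_(x in D) f x <= \int[mu]_(x in D) g x)%E.
Proof.
move=> mf mg fg; rewrite integralE [leRHS]integralE; apply: leeB.
- apply: ge0_le_integral => //; try exact: measurable_funepos.
  by move=> x Dx; rewrite !funeposE; rewrite ge_max !le_max lexx fg// orbT.
- apply: ge0_le_integral => //; try exact: measurable_funeneg.
  by move=> x Dx; rewrite !funenegE; rewrite ge_max !le_max lexx leeN2 fg// orbT.
Qed.

Lemma measurable_inv f : measurable_fun D f -> (forall x, D x -> 0 < f x) ->
  measurable_fun D (fun x => (f x)^-1).
Proof.
move=> mf f0; apply: (eq_measurable_fun (fun x => expR (- ln (f x)))).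
  by move=> x; rewrite inE => Dx; rewrite -lnV ?posrE ?f0// lnK// posrE invr_gt0 f0.
apply: measurableT_comp; first exact: measurable_expR.
apply: measurable_funN.
by apply: measurableT_comp => //; exact: measurable_ln.
Qed.

(** By monotone convergence the integral of [f] is the supremum of those of [h n]. This moves bounds
    between possibly infinite integrals and integrals of bounded functions. *)
Lemma ge0_monotone_integral_le (h : nat -> T -> R) (f : T -> \bar R) (M : \bar R) :
  (forall n, measurable_fun D (h n)) -> (forall n x, D x -> 0 <= h n x) ->
  (forall x, D x -> {homo h^~ x : m n / (m <= n)%N >-> m <= n}) ->
  (forall x, D x -> (h n x)%:E @[n --> \oo] --> f x) ->
  (\int[mu]_(x in D) f x <= M)%E <->
  (forall n, \int[mu]_(x in D) (h n x)%:E <= M)%E.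
Proof.
move=> mh h0 hh hf.
have mh' n : measurable_fun D (fun x => (h n x)%:E) by exact/measurable_EFinP.
have hh' x : D x -> {homo (fun n => (h n x)%:E) : m n / (m <= n)%N >-> (m <= n)%E}.
  by move=> Dx m n mn; rewrite lee_fin hh.
have := @cvg_monotone_convergence _ _ _ mu _ mD (fun n x => (h n x)%:E) mh'
  (fun n x Dx => h0 n x Dx) hh'.
have -> : (\int[mu]_(x in D) limn ((fun n x => (h n x)%:E)^~ x) = \int[mu]_(x in D) f x)%E.
  by apply: eq_integral => x; rewrite inE => Dx; exact/cvg_lim/hf.
move=> cv.
have nd : {homo (fun n => \int[mu]_(x in D) (h n x)%:E)%E :
    m n / (m <= n)%N >-> (m <= n)%E}.
  by move=> m n mn; apply: ge0_le_integral => // x Dx; [rewrite lee_fin h0|exact: hh'].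
have -> := cvg_unique _ cv (ereal_nondecreasing_cvgn nd) => //.
split => [supM n|hM]; first by apply: le_trans supM; exact/ereal_sup_ubound/imageT.
by apply: ge_ereal_sup => _ [n _ <-].
Qed.

(* h / (1 + s h) is bounded by 1/s and increases to h as s decreases to 0. *)
Lemma integral_le_of_shrunk (h : T -> R) (e M : R) : measurable_fun D h ->
  (forall x, D x -> 0 <= h x) -> 0 < e ->
  (forall s, 0 < s <= e -> \int[mu]_(x in D) (h x / (1 + s * h x)) <= M) ->
  (\int[mu]_(x in D) (h x)%:E <= M%:E)%E.
Proof.
move=> mh h0 e0 hM.
pose s (n : nat) := e * harmonic n.
have s0 n : 0 < s n by rewrite mulr_gt0// /harmonic/= invr_gt0.
have p0 n x : D x -> 0 < 1 + s n * h x.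
  by move=> Dx; rewrite ltr_pwDl// mulr_ge0// ?h0// ltW.
have ms n : measurable_fun D (fun x => 1 + s n * h x).
  by apply: measurable_funD; [exact: measurable_cst|
    apply: measurable_funM => //; exact: measurable_cst].
have mg n : measurable_fun D (fun x => h x / (1 + s n * h x)).
  by apply: measurable_funM => //; apply: measurable_inv => // x; exact: p0.
apply/(@ge0_monotone_integral_le (fun n x => h x / (1 + s n * h x))) => //.
- by move=> n x Dx; rewrite divr_ge0 ?h0// ltW// p0.
- move=> x Dx m n mn /=; apply: ler_wpM2l; first exact: h0.
  rewrite lef_pV2 ?posrE ?p0// lerD2l ler_wpM2r ?h0// ler_wpM2l ?(ltW e0)//.
  by rewrite /harmonic /= lef_pV2 ?posrE// ler_nat ltnS.
- move=> x Dx; apply: cvg_EFin; first exact: nearW.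
  rewrite -[X in _ --> X](_ : h x / (1 + (e * 0) * h x) = h x); last first.
    by rewrite mulr0 mul0r addr0 divr1.
  apply: cvgM (cvg_cst _) _; apply: cvgV; first by rewrite mulr0 mul0r addr0 oner_neq0.
  apply: cvgD (cvg_cst _) _; apply: cvgM (cvg_cst _); apply: cvgM (cvg_cst _) _.
  exact: cvg_harmonic.
- move=> n; rewrite integral_EFin ?lee_fin ?hM ?s0//=.
    by rewrite ger_pMr// invf_le1// ler1n.
  apply: (bounded_integrable (M := (s n)^-1)) => // x Dx.
  rewrite ger0_norm; last by rewrite divr_ge0 ?h0// ltW// p0.
  rewrite ler_pdivrMr ?p0// mulrDr mulr1 mulKf ?gt_eqF// lerDr.
  by rewrite invr_ge0 ltW.
Qed.

(** The functions 1/(q + k/(n+1)) are bounded and increase to 1/q, including the value +oo where q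
    vanishes. The scale [k] is left free so that the shift can be matched to a chosen sequence of
    proportions. *)
Lemma integral_inve_le (q : T -> R) (k M : R) : measurable_fun D q ->
  (forall x, D x -> 0 <= q x) -> 0 < k ->
  (\int[mu]_(x in D) ((q x)%:E)^-1 <= M%:E)%E <->
  (forall n, \int[mu]_(x in D) (q x + k * harmonic n)^-1 <= M).
Proof.
move=> mq q0 k0.
have k1 n : 0 < k * harmonic n by rewrite mulr_gt0// /harmonic/= invr_gt0.
have p0 n x : D x -> 0 < q x + k * harmonic n by move=> Dx; rewrite ltr_wpDl// q0.
have mp n : measurable_fun D (fun x => (q x + k * harmonic n)^-1).
  apply: measurable_inv => [|x]; last exact: p0.
  by apply: measurable_funD => //; exact: measurable_cst.
have ip n : mu.-integrable D (EFin \o (fun x => (q x + k * harmonic n)^-1)).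
  apply: (bounded_integrable (M := (k * harmonic n)^-1)) => // x Dx.
  rewrite gtr0_norm ?invr_gt0 ?p0// lef_pV2 ?posrE ?p0 ?k1// lerDr; exact: q0.
have cve : k * harmonic n @[n --> \oo] --> 0.
  by rewrite -(mulr0 k); apply: cvgM (cvg_cst _) _; exact: cvg_harmonic.
have [] := @ge0_monotone_integral_le (fun n x => (q x + k * harmonic n)^-1)
    (fun x => (q x)%:E^-1)%E M%:E mp.
- by move=> n x Dx; rewrite invr_ge0 ltW// p0.
- move=> x Dx m n mn /=; rewrite lef_pV2 ?posrE ?p0// lerD2l ler_wpM2l ?(ltW k0)//.
  by rewrite /harmonic /= lef_pV2 ?posrE// ler_nat ltnS.
- move=> x Dx; rewrite inver; case: ifPn => [/eqP qx0|qx0].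
    rewrite qx0; apply/cvgeryP; under eq_fun do rewrite add0r.
    by apply/(cvgrVy (f := fun n => k * harmonic n)); first exact: nearW.
  apply: cvg_EFin; first exact: nearW.
  by apply: cvgV => //; rewrite -[X in _ --> X]addr0; exact: cvgD (cvg_cst _) cve.
move=> h1 h2; split => [/h1 h n|h].
  by have := h n; rewrite integral_EFin.
by apply: h2 => n; rewrite integral_EFin ?lee_fin.
Qed.

(** Pointwise, |1/p - 1/q| = |p - q| / (p q) <= e / q <= e / m. Measuring the error relative to [p]
    accommodates unbounded payoffs. *)
Lemma Rintegral_inv_lipschitz p q (m e : R) : measurable_fun D p -> measurable_fun D q ->
  0 < m -> (forall x, D x -> m <= p x) -> (forall x, D x -> m <= q x) ->
  (forall x, D x -> `|p x - q x| <= e * p x) ->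
  `|\int[mu]_(x in D) (p x)^-1 - \int[mu]_(x in D) (q x)^-1| <= e / m.
Proof.
move=> mp mq m0 pm qm pq.
have p0 x : D x -> 0 < p x by move=> Dx; exact: lt_le_trans (pm _ Dx).
have q0 x : D x -> 0 < q x by move=> Dx; exact: lt_le_trans (qm _ Dx).
have mip := measurable_inv mp p0; have miq := measurable_inv mq q0.
have bip x : D x -> `|(p x)^-1| <= m^-1.
  by move=> Dx; rewrite gtr0_norm ?invr_gt0 ?p0// lef_pV2 ?posrE ?p0// pm.
have biq x : D x -> `|(q x)^-1| <= m^-1.
  by move=> Dx; rewrite gtr0_norm ?invr_gt0 ?q0// lef_pV2 ?posrE ?q0// qm.
have ip := bounded_integrable mip bip.
have iq := bounded_integrable miq biq.
have b x : D x -> `|(p x)^-1 - (q x)^-1| <= e / m.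
  move=> Dx; have -> : (p x)^-1 - (q x)^-1 = (q x - p x) / p x / q x.
    by field; rewrite !gt_eqF ?p0 ?q0.
  rewrite !normrM [X in _ * X](gtr0_norm _) ?invr_gt0 ?q0//.
  rewrite [X in _ * X / _](gtr0_norm _) ?invr_gt0 ?p0// distrC.
  have h : `|p x - q x| / p x <= e by rewrite ler_pdivrMr ?p0 ?pq.
  have e0 : 0 <= e by apply: le_trans h; rewrite divr_ge0// ltW// p0.
  by apply: ler_pM => //; [rewrite divr_ge0// ltW// p0|rewrite invr_ge0 ltW// q0|
    rewrite lef_pV2 ?posrE ?q0// qm].
rewrite -RintegralB//.
have id := bounded_integrable (measurable_funB mip miq) b.
apply: le_trans (le_normr_Rintegral mD id) _.
have -> : e / m = \int[mu]_(x in D) (e / m) by rewrite Rintegral_cst// D1 mulr1.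
apply: le_Rintegral => //.
- apply: (bounded_integrable (M := e / m)) => [|x Dx].
    by apply: measurableT_comp => //; exact: measurable_funB.
  by rewrite normr_id b.
- exact: (integrable_cst (e / m)).
Qed.

Lemma cvg_Rintegral_inv (q : R -> T -> R) (p : T -> R) (m s0 : R) (e : R -> R) :
  measurable_fun D p -> (forall s, measurable_fun D (q s)) ->
  0 < m -> (forall x, D x -> m <= p x) ->
  (\forall s \near s0, forall x, D x -> m <= q s x) ->
  (\forall s \near s0, forall x, D x -> `|p x - q s x| <= e s * p x) ->
  e s @[s --> s0] --> 0 ->
  \int[mu]_(x in D) (q s x)^-1 @[s --> s0] --> \int[mu]_(x in D) (p x)^-1.
Proof.
move=> mp mq m0 pm qm pq e0; apply/cvgrPdist_lt => r r0; near=> s.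
apply: le_lt_trans (Rintegral_inv_lipschitz (e := e s) mp (mq s) m0 pm _ _) _.
- by near: s; exact: qm.
- by near: s; exact: pq.
- rewrite ltr_pdivrMr//; near: s; apply: cvgr_lt e0 _ _; exact: mulr_gt0.
Unshelve. all: by end_near. Qed.

End probability_space.

(** * Wealth as a function of payoff, price and proportion *)

Definition wealth (R : realType) (y u t : R) : R := y * t / u - t + 1.

Section wealth_theory.
Context (R : realType).
Implicit Types y z c u s t : R.

Lemma wealthE y u t : wealth y u t = 1 + t * (y / u - 1).
Proof. by rewrite /wealth; ring. Qed.

Lemma wealth_le y z u t : 0 < u -> 0 <= t -> y <= z -> wealth y u t <= wealth z u t.
Proof.
move=> u0 t0 yz; rewrite !wealthE lerD2l ler_wpM2l// lerD2r ler_wpM2r//.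
by rewrite invr_ge0 ltW.
Qed.

Lemma wealth_gt0_le y u s t : 0 <= s <= t -> 0 < wealth y u t -> 0 < wealth y u s.
Proof.
rewrite !wealthE => /andP[s0 st] t1.
have [b0|b0] := leP 0 (y / u - 1); first by rewrite ltr_pwDl// mulr_ge0.
by apply: lt_le_trans t1 _; rewrite lerD2l ler_wnM2r// ltW.
Qed.

(** The number u / (u - c) is the proportion at which a payoff of c wipes out the capital. *)
Lemma wealth_gt0E c u t : 0 < u -> c < u -> (0 < wealth c u t) = (t < u / (u - c)).
Proof.
move=> u0 cu; rewrite ltr_pdivlMr ?subr_gt0//.
have -> : wealth c u t = (u - t * (u - c)) / u by rewrite /wealth; field; rewrite gt_eqF.
by rewrite pmulr_lgt0 ?invr_gt0// subr_gt0.
Qed.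

Lemma wealth_ge0E c u t : 0 < u -> c < u ->
  (0 <= wealth c u t) = (t <= u / (u - c)).
Proof.
move=> u0 cu; rewrite ler_pdivlMr ?subr_gt0//.
have -> : wealth c u t = (u - t * (u - c)) / u by rewrite /wealth; field; rewrite gt_eqF.
by rewrite pmulr_lge0 ?invr_gt0// subr_ge0.
Qed.

(** Changing the proportion or the price alters the wealth w by a small multiple of w - 1 or of w -
    1 + t. Since w >= z, constants are absorbed into multiples of w, which gives the relative error
    asked for by [cvg_Rintegral_inv]. *)
Lemma norm_subr1_le (w z t : R) : 0 < z -> z <= w -> 0 <= t ->
  `|w - 1 + t| <= (1 + (1 + t) / z) * w.
Proof.
move=> z0 zw t0; apply: (@le_trans _ _ (w + (1 + t))).
  by rewrite ler_norml; apply/andP; split; lra.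
rewrite mulrDl mul1r lerD2l mulrAC ler_pdivlMr// ler_wpM2l//; lra.
Qed.

End wealth_theory.

(** * Upper limits along punctured neighbourhoods within a set *)

Lemma limf_esup_within_le0 (R : realType) (f : R -> \bar R) (A : set R) (t0 : R) :
  (forall e, 0 < e -> \forall r \near t0, r != t0 -> A r -> (f r <= e%:E)%E) ->
  (limf_esup f (within A t0^') <= 0)%E.
Proof.
move=> h; apply/lee_addgt0Pr => e e0; rewrite add0e limf_esupE.
set U := [set r | (f r <= e%:E)%E].
have FU : within A t0^' U.
  by rewrite /within /dnbhs /within /=; apply: filterS (h _ e0) => r hr rt0 Ar; exact: hr.
apply: le_trans (ereal_inf_lbound (imageP (fun U => ereal_sup (f @` U)) FU)) _.
by apply: ge_ereal_sup => _ [r Ur <-].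
Qed.

(** The last hypothesis makes [t0] an accumulation point of [A]: every member of the filter then
    contains a point where f >= e, whereas a supremum over the empty set would be -oo. *)
Lemma limf_esup_within_gt0 (R : realType) (f : R -> \bar R) (A : set R) (t0 e : R) :
  0 < e -> (\forall r \near t0, r != t0 -> A r -> (e%:E <= f r)%E) ->
  (forall U, nbhs t0 U -> exists r, [/\ U r, r != t0 & A r]) ->
  (0 < limf_esup f (within A t0^'))%E.
Proof.
move=> e0 h cl; apply: (@lt_le_trans _ _ e%:E); first by rewrite lte_fin.
rewrite limf_esupE; apply: le_ereal_inf_tmp => _ [U FU <-].
have [r [[hr Ur] rt0 Ar]] := cl _ (filterI h FU).
by apply: le_trans (hr rt0 Ar) _; apply: ereal_sup_ubound; exists r => //; exact: Ur.
Qed.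

(** Puncturing removes the end that [t0] may coincide with, and closeness to [t0] avoids the ends
    that differ from it. Limits over admissible proportions thus involve interior ones only. *)
Lemma near_interior (R : realType) (m t0 : R) : 0 < m -> 0 <= t0 <= m ->
  \forall r \near t0, r != t0 -> 0 <= r <= m -> 0 < r < m.
Proof.
move=> m0 /andP[t00 t0m].
have n0 : \forall r \near t0, 0 < t0 -> 0 < r.
  have [h|h] := ltP 0 t0; last exact: filterE.
  by apply: filterS (lt_nbhsr h).
have nm : \forall r \near t0, t0 < m -> r < m.
  have [h|h] := ltP t0 m; last exact: filterE.
  by apply: filterS (lt_nbhsl h).
apply: filterS2 n0 nm => r r0 rm rt0 /andP[r_ge0 r_le]; apply/andP; split.
- move: t00; rewrite le_eqVlt => /predU1P[t00|//].
  by rewrite lt_def r_ge0 andbT t00.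
- move: t0m; rewrite le_eqVlt => /predU1P[t0m|//].
  by rewrite lt_neqAle r_le andbT -t0m.
Qed.

(** * The mean inverse wealth V: bounds and continuity *)

Definition mean_inv_wealth d (T : measurableType d) (R : realType)
    (mu : {measure set T -> \bar R}) (D : set T) (a : T -> R) (u t : R) : R :=
  \int[mu]_(x in D) (wealth (a x) u t)^-1.

Section mean_inv_wealth_theory.
Context d (T : measurableType d) (R : realType) (mu : {measure set T -> \bar R})
  (D : set T) (mD : measurable D) (D1 : mu D = 1%E).
(** Here [c] is an arbitrary lower bound, since the results are applied both with the infimum of the
    payoff and with the minimum of that infimum and 0. *)
Context (a : T -> R) (ma : measurable_fun D a) (c : R) (ca : forall x, D x -> c <= a x).
Hypothesis nc : forall v, ~ {ae mu, forall x, D x -> a x = v}.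
Implicit Types (u s t : R).
Local Notation V := (mean_inv_wealth mu D a).

Lemma measurable_wealth u t : measurable_fun D (fun x => wealth (a x) u t).
Proof.
rewrite /wealth; apply: measurable_funD; last exact: measurable_cst.
apply: measurable_funB; last exact: measurable_cst.
by do 2![apply: measurable_funM; last exact: measurable_cst].
Qed.

Lemma wealth_ge u t x : 0 < u -> 0 <= t -> D x -> wealth c u t <= wealth (a x) u t.
Proof. by move=> u0 t0 Dx; rewrite wealth_le// ca. Qed.

Lemma wealth_gt0 u t x : 0 < u -> 0 <= t -> 0 < wealth c u t -> D x -> 0 < wealth (a x) u t.
Proof. by move=> u0 t0 w0 Dx; exact: lt_le_trans w0 (wealth_ge u0 t0 Dx). Qed.

Lemma inv_wealth_le u t x : 0 < u -> 0 <= t -> 0 < wealth c u t -> D x ->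
  (wealth (a x) u t)^-1 <= (wealth c u t)^-1.
Proof.
by move=> u0 t0 w0 Dx; rewrite lef_pV2 ?posrE ?wealth_ge ?(wealth_gt0 u0 t0 w0 Dx).
Qed.

Lemma integrable_inv_wealth u t : 0 < u -> 0 <= t -> 0 < wealth c u t ->
  mu.-integrable D (EFin \o (fun x => (wealth (a x) u t)^-1)).
Proof.
move=> u0 t0 w0; apply: (bounded_integrable mD D1 (M := (wealth c u t)^-1)).
  by apply: measurable_inv => [|x]; [exact: measurable_wealth|exact: wealth_gt0].
by move=> x Dx; rewrite gtr0_norm ?invr_gt0 ?(wealth_gt0 u0 t0 w0 Dx)// inv_wealth_le.
Qed.

Lemma mean_inv_wealth_ge0 u t : 0 < u -> 0 <= t -> 0 < wealth c u t -> 0 <= V u t.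
Proof.
move=> u0 t0 w0; apply: Rintegral_ge0 => x Dx.
by rewrite invr_ge0 ltW// (wealth_gt0 u0 t0 w0 Dx).
Qed.

Lemma mean_inv_wealth_le u t : 0 < u -> 0 <= t -> 0 < wealth c u t ->
  V u t <= (wealth c u t)^-1.
Proof.
move=> u0 t0 w0; have -> : (wealth c u t)^-1 = \int[mu]_(x in D) (wealth c u t)^-1.
  by rewrite Rintegral_cst// D1 mulr1.
apply: le_Rintegral => //; first exact: integrable_inv_wealth.
- exact: (integrable_cst mD D1 (wealth c u t)^-1).
- by move=> x Dx; exact: inv_wealth_le.
Qed.

Lemma mean_inv_wealth_continuous_t u t : 0 < u -> 0 < t -> 0 < wealth c u t ->
  {for t, continuous (V u)}.
Proof.
move=> u0 t0 w0.
(* The wealths at t and s differ by (t - s)/t times w - 1. Half of [wealth c u t] is a lower bound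
   that survives for s near t. *)
apply: (@cvg_Rintegral_inv _ _ _ mu _ mD D1 (fun s x => wealth (a x) u s) _ (wealth c u t / 2) _
  (fun s => `|t - s| / t * (1 + (1 + 0) / wealth c u t))).
- exact: measurable_wealth.
- by move=> s; exact: measurable_wealth.
- by rewrite divr_gt0.
- by move=> x Dx; apply: le_trans (wealth_ge u0 (ltW t0) Dx); lra.
- have cw : wealth c u s @[s --> t] --> wealth c u t.
    apply: cvgD; last exact: cvg_cst.
    apply: cvgB; last exact: cvg_id.
    by apply: cvgM (cvg_cst _); apply: cvgM (cvg_cst _) cvg_id.
  near=> s => x Dx; apply: le_trans (wealth_ge u0 _ Dx); last first.
    by near: s; exact: lt_le_nbhsr.
  by near: s; apply: cvgr_ge cw _ _; lra.
- near=> s => x Dx.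
  have -> : wealth (a x) u t - wealth (a x) u s = (t - s) / t * (wealth (a x) u t - 1 + 0).
    by rewrite !wealthE; field; rewrite !gt_eqF.
  rewrite !normrM -!mulrA (gtr0_norm (x := t^-1)) ?invr_gt0//.
  apply: ler_wpM2l => //; apply: ler_wpM2l; first by rewrite invr_ge0 ltW.
  by apply: norm_subr1_le => //; exact: wealth_ge (ltW t0) Dx.
- rewrite -[X in _ --> X](_ : `|t - t| / t * (1 + (1 + 0) / wealth c u t) = 0); last first.
    by rewrite subrr normr0 !mul0r.
  apply: cvgM (cvg_cst _); apply: cvgM (cvg_cst _); apply: cvg_norm.
  exact: cvgB (cvg_cst _) cvg_id.
Unshelve. all: by end_near. Qed.

Lemma mean_inv_wealth_continuous_u u t : 0 < u -> 0 < t -> 0 < wealth c u t ->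
  {for u, continuous (V ^~ t)}.
Proof.
move=> u0 t0 w0.
have cinv : v^-1 @[v --> u] --> u^-1 by apply: cvgV cvg_id; rewrite gt_eqF.
(* The wealths at prices u and v differ by (1 - u/v) (w - 1 + t). *)
apply: (@cvg_Rintegral_inv _ _ _ mu _ mD D1 (fun v x => wealth (a x) v t) _ (wealth c u t / 2) _
  (fun v => `|1 - u / v| * (1 + (1 + t) / wealth c u t))).
- exact: measurable_wealth.
- by move=> s; exact: measurable_wealth.
- by rewrite divr_gt0.
- by move=> x Dx; apply: le_trans (wealth_ge u0 (ltW t0) Dx); lra.
- have cw : wealth c v t @[v --> u] --> wealth c u t.
    apply: cvgD; last exact: cvg_cst.
    apply: cvgB; last exact: cvg_cst.
    by apply: cvgM cinv; exact: cvg_cst.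
  near=> v => x Dx; apply: le_trans (wealth_ge _ (ltW t0) Dx); last first.
    by near: v; exact: lt_nbhsr.
  by near: v; apply: cvgr_ge cw _ _; lra.
- near=> v => x Dx.
  have v0 : 0 < v by near: v; exact: lt_nbhsr.
  have -> : wealth (a x) u t - wealth (a x) v t = (1 - u / v) * (wealth (a x) u t - 1 + t).
    by rewrite /wealth; field; rewrite !gt_eqF.
  rewrite normrM -mulrA; apply: ler_wpM2l => //.
  by apply: norm_subr1_le (ltW t0) => //; exact: wealth_ge (ltW t0) Dx.
- rewrite -[X in _ --> X](_ : `|1 - u / u| * (1 + (1 + t) / wealth c u t) = 0); last first.
    by rewrite divff ?gt_eqF// subrr normr0 !mul0r.
  apply: cvgM (cvg_cst _); apply: cvg_norm.
  by apply: cvgB (cvg_cst _) _; exact: cvgM (cvg_cst _) cinv.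
Unshelve. all: by end_near. Qed.

(** * Zero investment: comparing the expectation with the price *)

(** Since w - 1 >= 1 - 1/w, the payoff a = u + (u/t)(w - 1) is at least u + (u/t)(1 - 1/w).
    Integrating gives u + (u/t)(1 - V) <= E <= u. *)
Lemma mean_inv_wealth_ge1 u t : (\int[mu]_(x in D) (a x)%:E <= u%:E)%E ->
  0 < u -> 0 < t -> 0 < wealth c u t -> 1 <= V u t.
Proof.
move=> Eu u0 t0 w0.
have iw := integrable_inv_wealth u0 (ltW t0) w0.
have ig := integrableD mD (integrable_cst mD D1 (u / t + u)) (integrableZl mD (- (u / t)) iw).
have : (\int[mu]_(x in D) (u / t + u + - (u / t) * (wealth (a x) u t)^-1)%:E <=
        \int[mu]_(x in D) (a x)%:E)%E.
  apply: le_integral_measurable => //.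
  - by have /integrableP[mg _] := ig; apply: eq_measurable_fun mg => x _; rewrite /= EFinD EFinM.
  - exact/measurable_EFinP.
  - move=> x Dx; rewrite lee_fin; have := wealth_gt0 u0 (ltW t0) w0 Dx.
    rewrite wealthE => wx; rewrite -subr_ge0.
    have -> : a x - (u / t + u + - (u / t) * (1 + t * (a x / u - 1))^-1) =
      u * t * (a x / u - 1) ^+ 2 / (1 + t * (a x / u - 1)).
      have : 1 + t * (a x / u - 1) != 0 by rewrite gt_eqF.
      have : a x = u * (a x / u - 1) + u by field; rewrite gt_eqF.
      by move: (a x / u - 1) => b -> b0; field; rewrite b0 !gt_eqF.
    by apply: divr_ge0; [apply: mulr_ge0 (sqr_ge0 _); rewrite mulr_ge0// ltW|exact: ltW].
rewrite (@integral_EFin _ _ _ _ _ mD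
  (fun x => u / t + u + - (u / t) * (wealth (a x) u t)^-1)); last first.
  by move: ig; apply: eq_integrable => // x _; rewrite /= EFinD EFinM.
move=> /le_trans/(_ Eu); rewrite Rintegral_affine// lee_fin -/(V u t).
have ut0 : 0 < u / t by rewrite divr_gt0.
by rewrite -(ler_pM2l ut0); lra.
Qed.

(** Put h = a - c and t = s u with s small. The wealth is z + s h with z = 1 - s (u - c) <= 1, so
    h/(1 + s h) <= h/(z + s h) = (1 - z/(z + s h))/s. As V >= 1, the integral is at most (1 - z)/s =
    u - c, and s is sent to 0. *)
Lemma expectation_le_of_mean_inv_wealth u : 0 < u -> c < u ->
  (forall t, 0 < t < u / (u - c) -> 1 <= V u t) ->
  (\int[mu]_(x in D) (a x)%:E <= u%:E)%E.
Proof.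
move=> u0 cu V1.
have mh : measurable_fun D (fun x => a x - c).
  by apply: measurable_funB => //; exact: measurable_cst.
have h0 x : D x -> 0 <= a x - c by move=> Dx; rewrite subr_ge0 ca.
have uc : 0 < u - c by rewrite subr_gt0.
have hle : (\int[mu]_(x in D) (a x - c)%:E <= (u - c)%:E)%E.
  (* The bound s <= 1/(2 (u - c)) keeps s u strictly below u/(u - c). *)
  apply: (@integral_le_of_shrunk _ _ _ _ _ mD D1 _ ((u - c)^-1 / 2)) => //.
    by rewrite divr_gt0// invr_gt0.
  move=> s /andP[s0 s1].
  have tT : 0 < s * u < u / (u - c).
    rewrite mulr_gt0//= mulrC ltr_pM2l//; apply: le_lt_trans s1 _.
    by rewrite gtr_pMr ?invr_gt0// invf_lt1// ltr1n.
  have /andP[t0 tT'] := tT.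
  have w0 : 0 < wealth c u (s * u) by rewrite wealth_gt0E.
  have iw := integrable_inv_wealth u0 (ltW t0) w0.
  have wE x : wealth (a x) u (s * u) = wealth c u (s * u) + s * (a x - c).
    by rewrite /wealth; field; rewrite gt_eqF.
  have w1 : wealth c u (s * u) <= 1.
    rewrite wealthE gerDl; apply: mulr_ge0_le0; first exact: ltW.
    by rewrite subr_le0 ler_pdivrMr// mul1r ltW.
  apply: (@le_trans _ _ (\int[mu]_(x in D)
      (s^-1 + - (s^-1 * wealth c u (s * u)) * (wealth (a x) u (s * u))^-1))).
    apply: le_Rintegral => //.
    - apply: (bounded_integrable mD D1 (M := s^-1)).
        apply: measurable_funM => //; apply: measurable_inv => [|x Dx]; last first.
          by rewrite ltr_pwDl// mulr_ge0 ?h0// ltW.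
        apply: measurable_funD; first exact: measurable_cst.
        by apply: measurable_funM => //; exact: measurable_cst.
      move=> x Dx; have p0 : 0 < 1 + s * (a x - c) by rewrite ltr_pwDl// mulr_ge0 ?h0// ltW.
      rewrite ger0_norm; last by rewrite divr_ge0 ?h0// ltW.
      rewrite ler_pdivrMr// mulrDr mulr1 mulKf ?gt_eqF// lerDr.
      by rewrite invr_ge0 ltW.
    - have := integrableD mD (integrable_cst mD D1 s^-1)
        (integrableZl mD (- (s^-1 * wealth c u (s * u))) iw).
      by apply: eq_integrable => // x _; rewrite /= EFinD EFinM.
    - move=> x Dx; have wx := wealth_gt0 u0 (ltW t0) w0 Dx.
      rewrite -[leRHS](_ : (a x - c) / wealth (a x) u (s * u) = _); last first.
        rewrite wE in wx *; move: (wealth c u (s * u)) (a x - c) wx => z h wx.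
        by field; rewrite !gt_eqF.
      rewrite ler_wpM2l ?h0// lef_pV2 ?posrE//; last first.
        by rewrite ltr_pwDl// mulr_ge0 ?h0// ltW.
      by rewrite wE lerD2r.
  rewrite Rintegral_affine// -/(V u (s * u)) mulNr -mulrA.
  have -> : u - c = s^-1 - s^-1 * wealth c u (s * u).
    by rewrite /wealth; field; rewrite !gt_eqF.
  rewrite lerD2l lerN2; apply: ler_wpM2l; first by rewrite invr_ge0 ltW.
  by rewrite ler_peMr ?V1 ?(ltW w0).
(* The finite bound just obtained makes a - c integrable, so that c can be added back by
   linearity. *)
have ih : mu.-integrable D (EFin \o (fun x => a x - c)).
  apply/integrableP; split; first exact/measurable_EFinP.
  under eq_integral => x /[!inE] Dx do rewrite /= ger0_norm ?h0//.
  by apply: le_lt_trans hle _; rewrite ltry.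
have -> : (\int[mu]_(x in D) (a x)%:E = \int[mu]_(x in D) ((a x - c)%:E + c%:E))%E.
  by apply: eq_integral => x _; rewrite -EFinD subrK.
rewrite integralD// ?integral_cst//; last exact: integrable_cst.
by rewrite D1 mule1 -[u](subrK c) EFinD leeD2r.
Qed.

(** * Maximal investment: the mean of 1/(a - c) *)

Let q0 x : D x -> 0 <= a x - c.
Proof. by move=> Dx; rewrite subr_ge0 ca. Qed.

Let mq : measurable_fun D (fun x => a x - c).
Proof. by apply: measurable_funB => //; exact: measurable_cst. Qed.

(** At t = (1 - e) u/(u - c) one has (u - c) w = (1 - e)(a - c) + (u - c) e <= a - c + (u - c) e.
    Hence the mean of 1/(a - c + (u - c) e) is at most V/(u - c) <= 1/(u - c), and e is sent to
    0. *)
Lemma integral_inve_le_of_mean_inv_wealth u : 0 < u -> c < u ->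
  (forall t, 0 < t < u / (u - c) -> V u t <= 1) ->
  (\int[mu]_(x in D) ((a x - c)%:E)^-1 <= ((u - c)^-1)%:E)%E.
Proof.
move=> u0 cu V1; have uc : 0 < u - c by rewrite subr_gt0.
have uc2 : 0 < (u - c) / 2 by rewrite divr_gt0.
(* The factor 1/2 in the shift keeps e < 1 already at n = 0, so that t > 0. *)
apply/(integral_inve_le mD D1 _ mq q0 uc2) => n; pose e : R := (2 * n.+1%:R)^-1.
have e0 : 0 < e by rewrite invr_gt0 mulr_gt0.
have e1 : e < 1 by rewrite invf_lt1 ?mulr_gt0// -natrM ltr1n mulnS.
have -> : (u - c) / 2 * harmonic n = (u - c) * e by rewrite /e /harmonic /= invfM mulrA.
pose t := u / (u - c) * (1 - e).
have tT : 0 < t < u / (u - c).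
  have h : 0 < u / (u - c) by rewrite divr_gt0.
  by rewrite mulr_gt0 ?subr_gt0//= gtr_pMr// gtrDl oppr_lt0.
have /andP[t0 tT'] := tT.
have w0 : 0 < wealth c u t by rewrite wealth_gt0E.
have wE x : wealth (a x) u t = e + (1 - e) * (a x - c) / (u - c).
  by rewrite /t /wealth; field; rewrite !gt_eqF.
have iw := integrable_inv_wealth u0 (ltW t0) w0.
apply: (@le_trans _ _ (\int[mu]_(x in D) (0 + (u - c)^-1 * (wealth (a x) u t)^-1))).
  have p0 x : D x -> 0 < a x - c + (u - c) * e.
    by move=> Dx; rewrite ltr_wpDl ?q0// mulr_gt0.
  apply: le_Rintegral => //.
  - apply: (bounded_integrable mD D1 (M := ((u - c) * e)^-1)).
      apply: measurable_inv => //.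
      by apply: measurable_funD => //; exact: measurable_cst.
    move=> x Dx; rewrite gtr0_norm ?invr_gt0 ?p0// lef_pV2 ?posrE ?p0 ?mulr_gt0// lerDr.
    exact: q0.
  - have := integrableZl mD (u - c)^-1 iw.
    by apply: eq_integrable => // x _; rewrite /= add0r EFinM.
  - move=> x Dx; have wx := wealth_gt0 u0 (ltW t0) w0 Dx.
    rewrite add0r -invfM lef_pV2 ?posrE ?p0 ?mulr_gt0//.
    have -> : (u - c) * wealth (a x) u t = (1 - e) * (a x - c) + (u - c) * e.
      by rewrite wE; field; rewrite gt_eqF.
    by rewrite lerD2r ler_piMl ?q0// gerDl oppr_le0 ltW.
rewrite Rintegral_affine// add0r -/(V u t) ler_piMr ?V1//.
by rewrite invr_ge0 ltW.
Qed.

(** With s = t (u - c)/u, the wealth is the convex combination of 1 and (a - c)/(u - c) with weights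
    1 - s and s. Convexity of the inverse gives 1/w <= 1 - s + s (u - c)/(a - c), whose mean is at
    most 1. As a - c may vanish, this is done with a - c + 1/(n+1), at a cost tending to 0. *)
Lemma mean_inv_wealth_le1 u t : 0 < u -> c < u -> 0 < t < u / (u - c) ->
  (\int[mu]_(x in D) ((a x - c)%:E)^-1 <= ((u - c)^-1)%:E)%E -> V u t <= 1.
Proof.
move=> u0 cu /andP[t0 tT]; have uc : 0 < u - c by rewrite subr_gt0.
move/(@integral_inve_le _ _ _ _ _ mD D1 _ 1 _ mq q0 ltr01) => H.
have w0 : 0 < wealth c u t by rewrite wealth_gt0E.
pose s := t * (u - c) / u.
have s0 : 0 < s by rewrite divr_gt0// mulr_gt0.
have s1 : 0 < 1 - s.
  by rewrite subr_gt0 /s ltr_pdivrMr// mul1r -ltr_pdivlMr.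
have wE x : wealth (a x) u t = 1 - s + s * ((a x - c) / (u - c)).
  by rewrite /s /wealth; field; rewrite !gt_eqF.
have iw := integrable_inv_wealth u0 (ltW t0) w0.
(* The shift by e changes w by s e/(u - c), and both wealths are at least 1 - s; this bounds the
   change of 1/w by C e. *)
pose C := s / (u - c) / (1 - s) ^+ 2.
have C0 : 0 < C by apply: divr_gt0; [exact: divr_gt0|exact: exprn_gt0].
suff key n : V u t <= 1 + C * harmonic n.
  have cv : 1 + C * harmonic n @[n --> \oo] --> (1 : R).
    rewrite -[X in _ --> X]addr0 -[X in _ --> _ + X](mulr0 C).
    by apply: cvgD (cvg_cst _) _; apply: cvgM (cvg_cst _) _; exact: cvg_harmonic.
  by apply: (cvgr_to_ge cv); exact: nearW.
set e := harmonic n.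
have e0 : 0 < e by rewrite /e /harmonic /= invr_gt0.
have p0 x : D x -> 0 < a x - c + e by move=> Dx; rewrite ltr_wpDl ?q0.
have ip : mu.-integrable D (EFin \o (fun x => (a x - c + e)^-1)).
  apply: (bounded_integrable mD D1 (M := e^-1)).
    apply: measurable_inv => //.
    by apply: measurable_funD => //; exact: measurable_cst.
  move=> x Dx; rewrite gtr0_norm ?invr_gt0 ?p0// lef_pV2 ?posrE ?p0// lerDr.
  exact: q0.
apply: (@le_trans _ _ (\int[mu]_(x in D) ((1 - s + C * e) + s * (u - c) * (a x - c + e)^-1))).
  apply: le_Rintegral => //.
    have := integrableD mD (integrable_cst mD D1 (1 - s + C * e))
      (integrableZl mD (s * (u - c)) ip).
    by apply: eq_integrable => // x _; rewrite /= EFinD EFinM.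
  move=> x Dx; rewrite wE; have := q0 Dx; have {wE} := uc.
  rewrite /C; move: (u - c) (a x - c) => k q k0 qx0.
  (* Convexity of the inverse bounds 1/p_t once q is shifted by e (h1), and
     the shift costs at most C e (h2). *)
  pose y := (q + e) / k.
  have y0 : 0 < y by rewrite divr_gt0// ltr_wpDl.
  have qk : 0 <= q / k by rewrite divr_ge0// ltW.
  have r0 : 0 < 1 - s + s * (q / k) by rewrite ltr_pwDl// mulr_ge0// ltW.
  have r1 : 0 < 1 - s + s * y by rewrite addr_gt0// mulr_gt0.
  have h1 : (1 - s + s * y)^-1 <= 1 - s + s * y^-1.
    rewrite -subr_ge0.
    have -> : 1 - s + s / y - (1 - s + s * y)^-1 =
        (1 - s) * s * (y - 1) ^+ 2 / (y * (1 - s + s * y)).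
      by field; rewrite !gt_eqF.
    apply: divr_ge0; last by rewrite ltW// mulr_gt0.
    by apply: mulr_ge0 (sqr_ge0 _); rewrite mulr_ge0// ltW.
  have h2 : (1 - s + s * (q / k))^-1 - (1 - s + s * y)^-1 <= s / k / (1 - s) ^+ 2 * e.
    have -> : (1 - s + s * (q / k))^-1 - (1 - s + s * y)^-1 =
        s / k * e * ((1 - s + s * (q / k))^-1 * (1 - s + s * y)^-1).
      have -> : s * (q / k) = s * y - s / k * e by rewrite /y; field; rewrite gt_eqF.
      have : 1 - s + (s * y - s / k * e) != 0.
        have -> : s * y - s / k * e = s * (q / k) by rewrite /y; field; rewrite gt_eqF.
        by rewrite gt_eqF.
      move: r1; move: (s * y) (s / k * e) => A B r1 r0'.
      by field; rewrite r0' gt_eqF.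
    rewrite [leRHS]mulrAC; apply: ler_wpM2l; first by apply/ltW/mulr_gt0 => //; exact: divr_gt0.
    rewrite expr2 invfM; apply: ler_pM; rewrite ?invr_ge0 ?(ltW r0) ?(ltW r1)//.
      by rewrite lef_pV2 ?posrE// lerDl mulr_ge0// ltW.
    by rewrite lef_pV2 ?posrE// lerDl mulr_ge0// ltW.
  have -> : s * k / (q + e) = s * y^-1 by rewrite /y invfM invrK; ring.
  lra.
rewrite Rintegral_affine//.
have /(ler_wpM2l (ltW s0)) : (u - c) * \int[mu]_(x in D) (a x - c + e)^-1 <= 1.
  rewrite -(@ler_pM2l _ (u - c)^-1) ?invr_gt0// mulKf ?gt_eqF// mulr1.
  by have := H n; rewrite mul1r.
rewrite mulrA; lra.
Qed.

(** * The sign change of V - 1 *)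

(** With b = a/u - 1, the difference of the two sides is the mean of t s (t - s) b^2 / (p_t p_s). It
    is positive because a = u does not hold almost everywhere. This is the strict decrease of (1 -
    V)/t, cleared of denominators. *)
Lemma mean_inv_wealth_strict u s t : 0 < u -> 0 < s < t -> 0 < wealth c u t ->
  s * (1 - V u t) < t * (1 - V u s).
Proof.
move=> u0 /andP[s0 st] wt; have t0 := lt_trans s0 st.
have ws : 0 < wealth c u s by apply: wealth_gt0_le wt; rewrite ltW//= ltW.
pose f x := t - s + s * (wealth (a x) u t)^-1 + (- t) * (wealth (a x) u s)^-1.
have it := integrable_inv_wealth u0 (ltW t0) wt.
have is_ := integrable_inv_wealth u0 (ltW s0) ws.
have icst := integrable_cst mD D1 (t - s).
have fE x : D x -> f x = t * s * (t - s) * (a x / u - 1) ^+ 2 /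
    (wealth (a x) u t * wealth (a x) u s).
  move=> Dx; have := wealth_gt0 u0 (ltW t0) wt Dx; have := wealth_gt0 u0 (ltW s0) ws Dx.
  rewrite /f !wealthE; move: (a x / u - 1) => b ps pt.
  by field; rewrite !gt_eqF.
have : 0 < \int[mu]_(x in D) f x.
  apply: Rintegral_gt0 => //.
  - have := integrableD mD (integrableD mD icst (integrableZl mD s it)) (integrableZl mD (- t) is_).
    by apply: eq_integrable => // x _; rewrite /= !EFinD !EFinM.
  - move=> x Dx; rewrite fE//; apply: divr_ge0.
      by apply: mulr_ge0 (sqr_ge0 _); rewrite !mulr_ge0 ?subr_ge0//; exact: ltW.
    by apply: mulr_ge0; apply: ltW; apply: wealth_gt0 Dx => //; exact: ltW.
  - move=> aef; apply: (@nc u); apply: filterS aef => x /[swap] Dx /(_ Dx).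
    have [/eqP|b0] := eqVneq (a x / u - 1) 0.
      by rewrite subr_eq0 => /eqP h _; rewrite -[RHS]mul1r -h divfK// gt_eqF.
    move=> f0; suff : 0 < f x by rewrite f0 ltxx.
    rewrite fE//; apply: divr_gt0.
      apply: mulr_gt0; last by rewrite exprn_even_gt0.
      by rewrite !mulr_gt0 ?subr_gt0// (lt_trans s0).
    by apply: mulr_gt0; apply: wealth_gt0 Dx => //; exact: ltW.
rewrite Rintegral_affine2// -/(V u t) -/(V u s); lra.
Qed.

Lemma mean_inv_wealth_lt1 u s t : 0 < u -> 0 < s < t -> 0 < wealth c u t ->
  V u t <= 1 -> V u s < 1.
Proof.
move=> u0 st wt Vt; have := mean_inv_wealth_strict u0 st wt.
case/andP: st => s0 st; have t0 := lt_trans s0 st.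
have : 0 <= s * (1 - V u t) by rewrite mulr_ge0 ?subr_ge0// ltW.
by move=> /le_lt_trans/[apply]; rewrite pmulr_rgt0// subr_gt0.
Qed.

Lemma mean_inv_wealth_gt1 u s t : 0 < u -> 0 < s < t -> 0 < wealth c u t ->
  1 <= V u s -> 1 < V u t.
Proof.
move=> u0 st wt Vs; have := mean_inv_wealth_strict u0 st wt.
case/andP: st => s0 st; have t0 := lt_trans s0 st.
have : t * (1 - V u s) <= 0 by rewrite mulr_ge0_le0 ?subr_le0// ltW.
by move=> /[swap] /lt_le_trans/[apply]; rewrite pmulr_rlt0// subr_lt0.
Qed.

(* The point of [0, u / (u - c)] where V u - 1 changes sign. *)
Definition critical u t0 := [\/
  t0 = 0 /\ (forall t, 0 < t < u / (u - c) -> 1 <= V u t),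
  t0 = u / (u - c) /\ (forall t, 0 < t < u / (u - c) -> V u t <= 1) |
  0 < t0 < u / (u - c) /\ V u t0 = 1].

Lemma critical_ge0_le u t0 : 0 < u -> c < u -> critical u t0 -> 0 <= t0 <= u / (u - c).
Proof.
move=> u0 cu; have T0 : 0 < u / (u - c) by rewrite divr_gt0// subr_gt0.
by case=> [[-> _]|[-> _]|[/andP[? ?] _]]; rewrite ?lexx ltW//= ltW.
Qed.

Lemma critical_lt u t0 t : 0 < u -> c < u -> critical u t0 -> 0 < t -> t < t0 -> V u t < 1.
Proof.
move=> u0 cu crit t_gt0 tt0.
case: crit => [[t0E _]|[t0E VT]|[/andP[t00 t0T] V0]].
- by move: (lt_trans t_gt0 tt0); rewrite t0E ltxx.
- rewrite t0E in tt0.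
  (* Only V <= 1 is known here; strictness at t comes from comparison with a larger proportion, the
     midpoint of t and the right end. *)
  apply: (@mean_inv_wealth_lt1 u t ((t + u / (u - c)) / 2)) => //.
  + by rewrite t_gt0/= midf_lt.
  + by rewrite wealth_gt0E// midf_lt.
  + by apply: VT; rewrite midf_lt// andbT divr_gt0 ?addr_gt0// (lt_trans t_gt0).
- by apply: (@mean_inv_wealth_lt1 u t t0); rewrite ?wealth_gt0E ?V0// t_gt0.
Qed.

Lemma critical_gt u t0 t : 0 < u -> c < u -> critical u t0 -> t0 < t -> t < u / (u - c) ->
  1 < V u t.
Proof.
move=> u0 cu crit t0t tT.
case: crit => [[t0E VT]|[t0E _]|[/andP[t00 t0T] V0]].
- rewrite t0E in t0t.
  apply: (@mean_inv_wealth_gt1 u (t / 2) t) => //.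
  + by rewrite divr_gt0//= gtr_pMr// invf_lt1// ltr1n.
  + by rewrite wealth_gt0E.
  + apply: VT; rewrite divr_gt0//=; apply: lt_trans tT.
    by rewrite gtr_pMr// invf_lt1// ltr1n.
- by move: (lt_trans t0t tT); rewrite t0E ltxx.
- by apply: (@mean_inv_wealth_gt1 u t0 t); rewrite ?wealth_gt0E ?V0// t00.
Qed.

(** The negations give s with V < 1 and t with V > 1. Monotonicity of the sign forces s < t, and the
    intermediate value theorem applies on [s, t]. *)
Lemma critical_interior_exists u : 0 < u -> c < u ->
  ~ (forall t, 0 < t < u / (u - c) -> 1 <= V u t) ->
  ~ (forall t, 0 < t < u / (u - c) -> V u t <= 1) ->
  exists t, 0 < t < u / (u - c) /\ V u t = 1.
Proof.
move=> u0 cu /existsNP[s /not_implyP[/andP[s0 sT] /negP]]; rewrite -ltNge => Vs.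
move=> /existsNP[t /not_implyP[/andP[t0 tT] /negP]]; rewrite -ltNge => Vt.
have st : s < t.
  rewrite ltNge; apply/negP; rewrite le_eqVlt => /predU1P[ts|ts].
    by move: (lt_trans Vs Vt); rewrite ts ltxx.
  have : V u t < 1 by apply: mean_inv_wealth_lt1 (ltW Vs); rewrite ?t0 ?wealth_gt0E.
  by move=> /(lt_trans Vt); rewrite ltxx.
have cV : {within `[s, t], continuous (V u)}.
  apply: continuous_in_subspaceT => r; rewrite inE/= in_itv/= => /andP[sr rt].
  apply: (mean_inv_wealth_continuous_t u0).
    exact: lt_le_trans sr.
  by rewrite wealth_gt0E// (le_lt_trans rt).
have [|r] := IVT (ltW st) cV (v := 1).
  by rewrite ge_min le_max (ltW Vs) (ltW Vt) orbT.
rewrite in_itv/= => /andP[sr rt] Vr; exists r; split => //.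
by rewrite (lt_le_trans s0 sr) (le_lt_trans rt tT).
Qed.

(** A probe proportion just below [f u] has V u < 1. This persists at nearby prices v, so [f v]
    cannot lie below the probe, as V v > 1 past [f v]. A probe above [f u] gives the other bound. If
    there is no room for a probe, the bounds 0 and v/(v - c) on [f v] are used instead. *)
Lemma critical_continuous (f : R -> R) u : c <= 0 ->
  (forall v, 0 < v -> critical v (f v)) -> 0 < u -> {for u, continuous f}.
Proof.
move=> c0 crit u0; have cu : c < u by exact: le_lt_trans u0.
have [f0 fT] := andP (critical_ge0_le u0 cu (crit _ u0)).
have cT : v / (v - c) @[v --> u] --> u / (u - c).
  apply: cvgM; first exact: cvg_id.
  by apply: cvgV; [rewrite gt_eqF// subr_gt0|apply: cvgB (cvg_cst _); exact: cvg_id].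
have cV t : 0 < t < u / (u - c) -> {for u, continuous (V ^~ t)}.
  by move=> /andP[t0 tT]; apply: (mean_inv_wealth_continuous_u u0 t0); rewrite wealth_gt0E.
apply/cvgrPdist_lt => e e0.
have low : \forall v \near u, f u - e < f v.
  have [fe|fe] := ltP (f u - e) 0.
    near=> v; have v0 : 0 < v by near: v; exact: lt_nbhsr.
    apply: lt_le_trans fe _.
    by have /andP[] := critical_ge0_le v0 (le_lt_trans c0 v0) (crit _ v0).
  have t0 : 0 < f u - e / 2 by lra.
  have tT : f u - e / 2 < u / (u - c) by lra.
  have V1 : V u (f u - e / 2) < 1.
    by apply: (critical_lt u0 cu (crit _ u0)) => //; lra.
  near=> v; have v0 : 0 < v by near: v; exact: lt_nbhsr.
  have cv := le_lt_trans c0 v0.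
  suff : f u - e / 2 <= f v by lra.
  rewrite leNgt; apply/negP => fv.
  have : V v (f u - e / 2) < 1.
    by near: v; apply: (cvgr_lt _ (cV (f u - e / 2) _)); rewrite ?t0.
  apply/negP; rewrite -leNgt ltW//; apply: (critical_gt v0 cv (crit _ v0)) => //.
  by near: v; exact: (cvgr_gt _ cT).
have up : \forall v \near u, f v < f u + e.
  have [fe|fe] := leP (u / (u - c)) (f u + e / 2).
    near=> v; have v0 : 0 < v by near: v; exact: lt_nbhsr.
    have /andP[_ fv] := critical_ge0_le v0 (le_lt_trans c0 v0) (crit _ v0).
    apply: le_lt_trans fv _.
    by near: v; apply: (cvgr_lt _ cT); lra.
  have t0 : 0 < f u + e / 2 by lra.
  have V1 : 1 < V u (f u + e / 2).
    by apply: (critical_gt u0 cu (crit _ u0)) => //; lra.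
  near=> v; have v0 : 0 < v by near: v; exact: lt_nbhsr.
  have cv := le_lt_trans c0 v0.
  suff : f v <= f u + e / 2 by lra.
  rewrite leNgt; apply/negP => fv.
  have : 1 < V v (f u + e / 2).
    by near: v; apply: (cvgr_gt _ (cV (f u + e / 2) _)); rewrite ?t0.
  apply/negP; rewrite -leNgt ltW//.
  exact: (critical_lt v0 cv (crit _ v0)).
near=> v; rewrite ltr_norml.
have h1 : f u - e < f v by near: v.
have h2 : f v < f u + e by near: v.
by apply/andP; split; lra.
Unshelve. all: by end_near. Qed.

(** * Expected logarithmic gain, optimality and uniqueness *)

Let log_gain u t r : \bar R :=
  (\int[mu]_(x in D) (ln (wealth (a x) u t / wealth (a x) u r))%:E)%E.

Lemma measurable_log_wealth_ratio u t r : (forall x, D x -> 0 < wealth (a x) u r) ->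
  measurable_fun D (fun x => (ln (wealth (a x) u t / wealth (a x) u r))%:E).
Proof.
move=> r0; apply/measurable_EFinP; apply: measurableT_comp; first exact: measurable_ln.
apply: measurable_funM; first exact: measurable_wealth.
by apply: measurable_inv => //; exact: measurable_wealth.
Qed.

(** This integrates ln y <= y - 1 at y = p_t/p_r, where y - 1 = (t/r - 1)(1 - 1/p_r). *)
Lemma log_gain_le u t r : 0 < u -> c < u -> 0 < r < u / (u - c) ->
  (forall x, D x -> 0 < wealth (a x) u t) ->
  (log_gain u t r <= ((t / r - 1) * (1 - V u r))%:E)%E.
Proof.
move=> u0 cu /andP[r0 rT] wt.
have w0 : 0 < wealth c u r by rewrite wealth_gt0E.
have ir := integrable_inv_wealth u0 (ltW r0) w0.
have wr x : D x -> 0 < wealth (a x) u r by exact: wealth_gt0 u0 (ltW r0) w0.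
have ig : mu.-integrable D (EFin \o (fun x => (t / r - 1) + (1 - t / r) * (wealth (a x) u r)^-1)).
  have := integrableD mD (integrable_cst mD D1 (t / r - 1)) (integrableZl mD (1 - t / r) ir).
  by apply: eq_integrable => // x _; rewrite /= EFinD EFinM.
have -> : (t / r - 1) * (1 - V u r) =
    \int[mu]_(x in D) ((t / r - 1) + (1 - t / r) * (wealth (a x) u r)^-1).
  by rewrite Rintegral_affine// -/(V u r); ring.
rewrite -integral_EFin//; apply: le_integral_measurable => //.
- exact: measurable_log_wealth_ratio.
- by have /integrableP[] := ig.
- move=> x Dx; rewrite lee_fin.
  have y0 : 0 < wealth (a x) u t / wealth (a x) u r by rewrite divr_gt0 ?wt ?wr.
  rewrite -[X in ln X](subrK 1) addrC.
  apply: (@le_trans _ _ (wealth (a x) u t / wealth (a x) u r - 1)).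
    by apply: le_ln1Dx; rewrite ltrBrDl subrr.
  have := wr _ Dx; rewrite !wealthE; move: (a x / u - 1) => b br.
  by rewrite le_eqVlt; apply/predU1P; left; field; rewrite !gt_eqF.
Qed.

(** The same inequality with t and r exchanged, -ln y >= 1 - y at y = p_r/p_t, gives a bound through
    V at the fixed t rather than at the moving r. *)
Lemma log_gain_ge u t r : 0 < u -> c < u -> 0 < r < u / (u - c) -> 0 < t < u / (u - c) ->
  (((1 - r / t) * (1 - V u t))%:E <= log_gain u t r)%E.
Proof.
move=> u0 cu /andP[r0 rT] /andP[t0 tT].
have w0 : 0 < wealth c u t by rewrite wealth_gt0E.
have it := integrable_inv_wealth u0 (ltW t0) w0.
have wt x : D x -> 0 < wealth (a x) u t by exact: wealth_gt0 u0 (ltW t0) w0.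
have wr x : D x -> 0 < wealth (a x) u r.
  by move=> Dx; apply: (wealth_gt0 u0 (ltW r0)) => //; rewrite wealth_gt0E.
have ig : mu.-integrable D (EFin \o (fun x => (1 - r / t) + (r / t - 1) * (wealth (a x) u t)^-1)).
  have := integrableD mD (integrable_cst mD D1 (1 - r / t)) (integrableZl mD (r / t - 1) it).
  by apply: eq_integrable => // x _; rewrite /= EFinD EFinM.
have -> : (1 - r / t) * (1 - V u t) =
    \int[mu]_(x in D) ((1 - r / t) + (r / t - 1) * (wealth (a x) u t)^-1).
  by rewrite Rintegral_affine// -/(V u t); ring.
rewrite -integral_EFin//; apply: le_integral_measurable => //.
- by have /integrableP[] := ig.
- exact: measurable_log_wealth_ratio.
- move=> x Dx; rewrite lee_fin.
  have y0 : 0 < wealth (a x) u r / wealth (a x) u t by rewrite divr_gt0 ?wt ?wr.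
  rewrite -(invf_div (wealth (a x) u r)) lnV ?posrE// lerNr.
  rewrite -[X in ln X](subrK 1) addrC.
  apply: (@le_trans _ _ (wealth (a x) u r / wealth (a x) u t - 1)).
    by apply: le_ln1Dx; rewrite ltrBrDl subrr.
  have := wt _ Dx; rewrite !wealthE; move: (a x / u - 1) => b br.
  by rewrite le_eqVlt; apply/predU1P; left; field; rewrite !gt_eqF.
Qed.

Lemma critical_optimal u t0 (A : set R) t : 0 < u -> c < u ->
  (forall s, A s -> 0 <= s <= u / (u - c) /\ forall x, D x -> 0 < wealth (a x) u s) ->
  critical u t0 -> A t ->
  (limf_esup (log_gain u t) (within A t0^') <= 0)%E.
Proof.
move=> u0 cu AT crit At; have [/andP[t_ge0 tT] wt] := AT _ At.
have T0 : 0 < u / (u - c) by rewrite divr_gt0// subr_gt0.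
apply: limf_esup_within_le0 => e e0.
(* By [log_gain_le] only this upper bound matters. For interior [t0] it follows from continuity of
   V; at the two ends, crude bounds on V replace continuity. *)
suff key : \forall r \near t0, 0 < r < u / (u - c) -> (t / r - 1) * (1 - V u r) <= e.
  apply: filterS2 (near_interior T0 (critical_ge0_le u0 cu crit)) key.
  move=> r ri key rt0 /AT[rT _]; have {}rT := ri rt0 rT.
  apply: le_trans (log_gain_le u0 cu rT wt) _.
  by rewrite lee_fin key.
case: crit => [[-> VT]|[-> VT]|[/andP[t00 t0T] V0]].
(* Near 0 one has V >= 1, so the quantity is at most V - 1 <= 1/(wealth c u r) - 1, which tends to
   0. *)
- have cw : (wealth c u r)^-1 @[r --> 0] --> (1 : R).
    rewrite -[X in _ --> X](_ : (wealth c u 0)^-1 = 1); last first.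
      by rewrite /wealth mulr0 mul0r !add0r oppr0 add0r invr1.
    apply: cvgV; first by rewrite /wealth mulr0 mul0r !add0r oppr0 add0r oner_neq0.
    apply: cvgD; last exact: cvg_cst.
    apply: cvgB; last exact: cvg_id.
    by apply: cvgM (cvg_cst _); apply: cvgM (cvg_cst _) cvg_id.
  have h3 : \forall r \near 0, (wealth c u r)^-1 <= 1 + e.
    by apply: (cvgr_le _ cw); rewrite ltrDl.
  apply: filterS h3 => r h3 /andP[r0 rT].
  have wr : 0 < wealth c u r by rewrite wealth_gt0E.
  have V1 := VT r; have V2 := mean_inv_wealth_le u0 (ltW r0) wr.
  have h1 : 0 <= V u r - 1 by rewrite subr_ge0 V1// r0.
  have h2 : 0 <= t / r * (V u r - 1) by rewrite mulr_ge0// divr_ge0// ltW.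
  lra.
(* Near m one has 0 <= V <= 1 and t <= m, so the quantity is at most m/r - 1. *)
- set m := u / (u - c) in T0 tT VT *.
  have cr : m / r @[r --> m] --> (1 : R).
    rewrite -[X in _ --> X](_ : m / m = 1); last by rewrite divff// gt_eqF.
    by apply: cvgM (cvg_cst _) _; apply: cvgV; rewrite ?gt_eqF.
  have h3 : \forall r \near m, m / r <= 1 + e.
    by apply: (cvgr_le _ cr); rewrite ltrDl.
  apply: filterS h3 => r h3 /andP[r0 rT].
  have wr : 0 < wealth c u r by rewrite wealth_gt0E.
  have V1 : V u r <= 1 by rewrite VT// r0.
  have V2 := mean_inv_wealth_ge0 u0 (ltW r0) wr.
  have h1 : 1 <= m / r by rewrite ler_pdivlMr// mul1r ltW.
  have h2 : 0 <= (m / r - t / r) * (1 - V u r).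
    by rewrite mulr_ge0 ?subr_ge0// ler_wpM2r// invr_ge0 ltW.
  have h4 : 0 <= (m / r - 1) * V u r by rewrite mulr_ge0// subr_ge0.
  lra.
- have cV : {for t0, continuous (V u)}.
    by apply: (mean_inv_wealth_continuous_t u0 t00); rewrite wealth_gt0E.
  have cv : (t / r - 1) * (1 - V u r) @[r --> t0] --> 0.
    rewrite -[X in _ --> X](_ : (t / t0 - 1) * (1 - V u t0) = 0); last first.
      by rewrite V0 subrr mulr0.
    apply: cvgM; last by apply: cvgB (cvg_cst _) cV.
    apply: cvgB; last exact: cvg_cst.
    by apply: cvgM (cvg_cst _) _; apply: cvgV; rewrite ?gt_eqF.
  by near=> r => _; near: r; exact: (cvgr_le _ cv).
Unshelve. all: by end_near. Qed.

(** If t1 differs from t0, their midpoint t beats t1: V - 1 at t has the sign that makes (1 -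
    t1/t)(1 - V u t) positive, and by [log_gain_ge] the gain over r stays above half of this for r
    near t1. *)
Lemma optimal_critical_unique u t0 t1 (A : set R) : 0 < u -> c < u ->
  (forall s, A s -> 0 <= s <= u / (u - c)) ->
  (forall s, 0 < s < u / (u - c) -> A s) ->
  critical u t0 -> 0 <= t1 <= u / (u - c) ->
  (forall t, A t -> (limf_esup (log_gain u t) (within A t1^') <= 0)%E) -> t1 = t0.
Proof.
move=> u0 cu AT TA crit t1T opt; apply: contrapT => /eqP t10.
have T0 : 0 < u / (u - c) by rewrite divr_gt0// subr_gt0.
have [t00 t0T] := andP (critical_ge0_le u0 cu crit).
have /andP[t1_ge0 t1_le] := t1T.
pose t := (t0 + t1) / 2.
have tT : 0 < t < u / (u - c).
  by rewrite /t; move: t10; rewrite neq_lt => /orP[] h; apply/andP; split; lra.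
have /andP[t_gt0 t_lt] := tT.
have e0 : 0 < (1 - t1 / t) * (1 - V u t).
  move: t10; rewrite neq_lt => /orP[] h.
    have h1 : t1 < t by rewrite /t; lra.
    have h2 : t < t0 by rewrite /t; lra.
    have V1 := critical_lt u0 cu crit t_gt0 h2.
    by rewrite mulr_gt0 ?subr_gt0// ltr_pdivrMr// mul1r.
  have h1 : t < t1 by rewrite /t; lra.
  have h2 : t0 < t by rewrite /t; lra.
  have V1 := critical_gt u0 cu crit h2 t_lt.
  by rewrite nmulr_lgt0 ?subr_lt0// ltr_pdivlMr// mul1r.
suff : (0 < limf_esup (log_gain u t) (within A t1^'))%E.
  by rewrite ltNge opt//; exact: TA.
apply: (@limf_esup_within_gt0 _ _ _ _ ((1 - t1 / t) * (1 - V u t) / 2)).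
- by rewrite divr_gt0.
- have cv : (1 - r / t) * (1 - V u t) @[r --> t1] --> (1 - t1 / t) * (1 - V u t).
    apply: cvgM (cvg_cst _); apply: cvgB (cvg_cst _) _.
    by apply: cvgM (cvg_cst _); exact: cvg_id.
  have ce : \forall r \near t1, (1 - t1 / t) * (1 - V u t) / 2 <= (1 - r / t) * (1 - V u t).
    by apply: (cvgr_ge _ cv); lra.
  apply: filterS2 (near_interior T0 t1T) ce => r ri ce rt1 /AT rT.
  apply: le_trans (log_gain_ge u0 cu (ri rt1 rT) tT).
  by rewrite lee_fin.
- move=> U /nbhs_ballP[e /= e_gt0 eU].
  have n0 : 0 < `|t - t1|.
    by rewrite normr_gt0 subr_eq0 /t; apply/eqP => h; move/eqP: t10; apply; lra.
  (* As 0 < s < 1 and s |t - t1| < e, the point t1 + s (t - t1) lies in the ball and strictly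
     between t1 and t. *)
  pose s := e / (e + `|t - t1|).
  have s0 : 0 < s by rewrite divr_gt0// addr_gt0.
  have s1 : s < 1 by rewrite ltr_pdivrMr ?addr_gt0// mul1r ltrDl.
  exists (t1 + s * (t - t1)); split.
  + apply: eU; rewrite /ball /= opprD addrA subrr add0r normrN normrM gtr0_norm//.
    by rewrite /s mulrAC ltr_pdivrMr ?addr_gt0// mulrDr ltrDr mulr_gt0.
  + rewrite -subr_eq0 addrAC subrr add0r.
    by apply: mulf_neq0; [rewrite gt_eqF|rewrite -normr_gt0].
  + apply: TA; have -> : t1 + s * (t - t1) = (1 - s) * t1 + s * t by ring.
    have st : 0 < s * t by rewrite mulr_gt0.
    have st' : s * t < s * (u / (u - c)) by rewrite ltr_pM2l.
    have h1 : 0 <= (1 - s) * t1 by rewrite mulr_ge0// subr_ge0 ltW.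
    have h2 : (1 - s) * t1 <= (1 - s) * (u / (u - c)) by rewrite ler_wpM2l// subr_ge0 ltW.
    by apply/andP; split; lra.
Unshelve. all: by end_near. Qed.

End mean_inv_wealth_theory.

Lemma lee_inve (R : realType) (h : \bar R) (k : R) : (0 <= h)%E -> 0 < k ->
  (k%:E <= h^-1)%E = (h <= (k^-1)%:E)%E.
Proof.
case: h => [r| |] //= h0 k0.
  rewrite inver; case: ifPn => [/eqP ->|r0].
    by rewrite leey lee_fin invr_ge0 ltW.
  have {}h0 : 0 < r by rewrite lt_def r0.
  by rewrite !lee_fin -[in LHS](invrK k) lef_pV2 ?posrE ?invr_gt0.
by rewrite invey lee_fin leNgt k0.
Qed.

(** Suppose a = v almost everywhere. If v > b, the set where a < v is null, against the third
    measure hypothesis on [a] taken at e = v - b. If v <= b, the set where a < b + e has full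
    measure for every e > 0. *)
Lemma not_ae_cst d (T : measurableType d) (R : realType) (mu : {measure set T -> \bar R})
    (D : set T) (a : T -> R) (b : R) : measurable D -> mu D = 1%E -> measurable_fun D a ->
  (forall x, D x -> b <= a x) ->
  (forall e, 0 < e -> (0 < mu [set x | D x /\ (a x < b + e)%R])%E) ->
  (exists2 e, 0 < e & (mu [set x | D x /\ (a x < b + e)%R] < 1)%E) ->
  forall v, ~ {ae mu, forall x, D x -> a x = v}.
Proof.
move=> mD D1 ma ba essinf [e e0 e1] v aev.
have mA r : measurable [set x | D x /\ a x < r].
  rewrite [X in measurable X](_ : _ = D `&` a @^-1` `]-oo, r[%classic).
    exact: ma.
  by apply/seteqP; split => x /=; rewrite in_itv.
have [bv|vb] := ltP b v.
  have := essinf (v - b); rewrite subr_gt0 => /(_ bv).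
  rewrite (_ : mu _ = 0)%E ?ltxx//.
  apply/measure_negligible => //; apply: negligibleS aev => x [Dx].
  by rewrite addrC subrK => /[swap] /(_ Dx) ->; rewrite ltxx.
have D0 : mu (D `\` [set x | D x /\ a x < b + e]) = 0%E.
  apply/measure_negligible; first exact: measurableD.
  apply: negligibleS aev => x [Dx nx] /(_ Dx) ax.
  by apply: nx; split => //; rewrite ax; apply: le_lt_trans vb _; rewrite ltrDl.
move: e1; rewrite ltNge => /negP; apply.
rewrite -D1 -[X in (mu X <= _)%E](setDUK (A := [set x | D x /\ a x < b + e])); last by move=> x [].
apply: le_trans (measureU2 _ _ _) _ => //; first exact: measurableD.
by rewrite -[leRHS]adde0 -D0.
Qed.

(** * Identification of [t_bar] with the sign change *)

Section t_bar_optimal.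
Context (R : realType) (I : interval R) (F : cumulativeBounded (0 : R) (1 : R)) (a : R -> R).
Hypothesis F_on_I : is_distribution_on I F.
Hypothesis a_meas : measurable_fun [set` I] a.
Hypothesis a_lbound : has_lbound (a @` [set` I]).
Hypothesis xi_essinf : forall e : R, 0 < e ->
      (0 < lebesgue_stieltjes_measure F
             [set x | x \in I /\ (a x < xi I a + e)%R])%E.
Hypothesis a_nonconst : exists2 d : R, 0 < d &
      (lebesgue_stieltjes_measure F
         [set x | x \in I /\ (a x < xi I a + d)%R] < 1)%E.

Local Notation mu := (lebesgue_stieltjes_measure F).
Local Notation D := [set` I].
Local Notation V := (mean_inv_wealth mu D a).
Local Notation xi := (xi I a).
(* This choice of c merges the cases 0 <= xi and xi < 0 of [t_bar]. *)
Let c := Num.min xi 0.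

Let mD : measurable (D : set (measurableTypeR R)). Proof. exact: measurable_itv. Qed.

Let D1 : mu D = 1%E. Proof. exact: F_on_I. Qed.

Lemma xi_le x : D x -> xi <= a x.
Proof. by move=> Dx; apply: ge_inf => //; exists x. Qed.

Lemma min_xi_le x : D x -> c <= a x.
Proof. by move=> Dx; rewrite /c ge_min xi_le. Qed.

Let nc v : ~ {ae mu, forall x, D x -> a x = v}.
Proof. exact: (not_ae_cst mD D1 a_meas xi_le xi_essinf a_nonconst). Qed.

(** The numerator of the integrand is (u/t)(p_t - 1) and its denominator u p_t, so that t w = 1 -
    V. *)
Lemma w_eq0 u t : 0 < u -> 0 < t -> 0 < wealth xi u t ->
  w I F a u t = 0%E <-> V u t = 1.
Proof.
move=> u0 t0 wt.
have iw := integrable_inv_wealth mD D1 a_meas xi_le u0 (ltW t0) wt.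
have -> : w I F a u t = (t^-1 * (1 - V u t))%:E.
  have -> : t^-1 * (1 - V u t) = \int[mu]_(x in D) (t^-1 + - t^-1 * (wealth (a x) u t)^-1).
    by rewrite Rintegral_affine// -/(V u t); ring.
  rewrite -integral_EFin//; last first.
    have := integrableD mD (integrable_cst mD D1 t^-1) (integrableZl mD (- t^-1) iw).
    by apply: eq_integrable => // x _; rewrite /= EFinD EFinM.
  apply: eq_integral => x; rewrite inE => Dx; congr (_%:E).
  have := wealth_gt0 xi_le u0 (ltW t0) wt Dx.
  have -> : a x * t - u * t + u = u * wealth (a x) u t.
    by rewrite /wealth; field; rewrite gt_eqF.
  have -> : a x - u = u / t * (wealth (a x) u t - 1).
    by rewrite /wealth; field; rewrite !gt_eqF.
  by move: (wealth _ _ _) => y y0; field; rewrite !gt_eqF.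
split => [[/eqP]|->]; last by rewrite subrr mulr0.
by rewrite mulf_eq0 invr_eq0 gt_eqF//= subr_eq0 => /eqP.
Qed.

Lemma min_xi_lt u : 0 < u -> c < u.
Proof. by move=> u0; rewrite /c gt_min u0 orbT. Qed.

(** The choice in [t_tilde] ranges over ]0, u/(u - xi)[, which exceeds ]0, u/(u - c)[ when 0 < xi. A
    zero exists in the smaller interval, and uniqueness in the larger one identifies it with the
    chosen point. *)
Lemma t_tilde_critical u : 0 < u ->
  ~ (forall t, 0 < t < u / (u - c) -> 1 <= V u t) ->
  ~ (forall t, 0 < t < u / (u - c) -> V u t <= 1) ->
  0 < t_tilde I F a u < u / (u - c) /\ V u (t_tilde I F a u) = 1.
Proof.
move=> u0 V1 V2; have cu := min_xi_lt u0.
(* Otherwise every wealth is at least 1 and V <= 1 throughout. *)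
have xu : xi < u.
  rewrite ltNge; apply/negP => ux; apply: V2 => t /andP[t0 _].
  have w1 : 1 <= wealth xi u t.
    rewrite wealthE lerDl mulr_ge0 ?(ltW t0)// subr_ge0.
    by rewrite ler_pdivlMr// mul1r.
  have w0 : 0 < wealth xi u t by exact: lt_le_trans w1.
  apply: le_trans (mean_inv_wealth_le mD D1 a_meas xi_le u0 (ltW t0) w0) _.
  by rewrite invf_le1.
have [r [/andP[r0 rT] Vr]] :=
  critical_interior_exists mD D1 a_meas min_xi_le nc u0 cu V1 V2.
have cxi : u / (u - c) <= u / (u - xi).
  rewrite ler_pM2l// lef_pV2 ?posrE ?subr_gt0// lerD2l lerN2.
  by rewrite /c ge_min lexx.
have rT' := lt_le_trans rT cxi.
have wr : 0 < wealth xi u r by rewrite wealth_gt0E.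
have [/andP[s0 sT] /w_eq0 Vs] : 0 < t_tilde I F a u < u / (u - xi) /\
    w I F a u (t_tilde I F a u) = 0%E.
  apply: (xgetPex 0 (P := [set t | 0 < t < u / (u - xi) /\ w I F a u t = 0%E])).
  by exists r; split; [rewrite r0|apply/w_eq0].
have ws : 0 < wealth xi u (t_tilde I F a u) by rewrite wealth_gt0E.
have {}Vs := Vs u0 s0 ws.
suff -> : t_tilde I F a u = r by rewrite r0 rT.
apply/eqP; rewrite eq_le !leNgt; apply/andP; split; apply/negP => h.
  have := mean_inv_wealth_lt1 mD D1 a_meas xi_le nc u0 _ ws (s := r).
  by rewrite r0 h Vs lexx Vr ltxx => /(_ erefl erefl).
have := mean_inv_wealth_lt1 mD D1 a_meas xi_le nc u0 _ wr (s := t_tilde I F a u).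
by rewrite s0 h Vs Vr lexx ltxx => /(_ erefl erefl).
Qed.

(** If 0 <= xi then c = 0, and u/(u - c) = 1. If xi < 0 then c = xi, and for u > 0 the test on the
    maximum amounts to u - xi <= 1/H_xi. In both cases [lee_inve] inverts the test. *)
Lemma t_barE u : 0 < u -> t_bar I F a u =
  if (H_at I F a c <= ((u - c)^-1)%:E)%E then u / (u - c)
  else if (u%:E < expectation_a I F a)%E then t_tilde I F a u else 0.
Proof.
move=> u0; have cu := min_xi_lt u0.
have H0 : (0 <= H_at I F a c)%E.
  apply: integral_ge0 => x Dx; rewrite inve_ge0 lee_fin subr_ge0.
  exact: min_xi_le.
rewrite -lee_inve ?subr_gt0// /t_bar.
have [xi0|xi0] := leP 0 xi.
  by rewrite /H /c (min_idPr xi0) subr0 divff// gt_eqF.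
rewrite le_max lee_fin (leNgt u) u0/= /H_xi /c (min_idPl (ltW xi0)).
by rewrite -leeBlDl// -EFinB.
Qed.

(** Each test in [t_bar] decides whether V - 1 keeps one sign on the whole interval; when both fail,
    the sign changes inside, at [t_tilde]. *)
Lemma t_bar_critical u : 0 < u -> critical mu D a c u (t_bar I F a u).
Proof.
move=> u0; have cu := min_xi_lt u0; rewrite t_barE//.
case: ifPn => [Hle|/negP nH].
  constructor 2; split=> // t tT.
  exact: (mean_inv_wealth_le1 mD D1 a_meas min_xi_le u0 cu tT Hle).
case: ifPn => [uE|]; last rewrite -leNgt => Eu.
  constructor 3; apply: t_tilde_critical => // V1.
    move: uE; rewrite ltNge => /negP; apply.
    exact: (expectation_le_of_mean_inv_wealth mD D1 a_meas min_xi_le u0 cu V1).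
  apply: nH.
  exact: (integral_inve_le_of_mean_inv_wealth mD D1 a_meas min_xi_le u0 cu V1).
constructor 1; split=> // t /andP[t0 tT].
apply: (mean_inv_wealth_ge1 mD D1 a_meas min_xi_le Eu u0 t0).
by rewrite wealth_gt0E.
Qed.

(** With [interior_admissible], this encloses the admissible set between ]0, u/(u - c)[ and
    [0, u/(u - c)], as [optimal_critical_unique] requires. *)
Lemma admissible_sub u s : 0 < u -> admissible I a u s ->
  0 <= s <= u / (u - c) /\ forall x, D x -> 0 < wealth (a x) u s.
Proof.
move=> u0 [/andP[s0 s1] ws]; split; last by move=> x; exact: (wealth_gt0 xi_le u0 s0 ws).
rewrite s0/= /c; have [xi0|xi0] := leP xi 0.
  by rewrite -wealth_ge0E ?(le_lt_trans xi0)// ltW.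
by rewrite subr0 divff// gt_eqF.
Qed.

Lemma sup_admissible_le1 u : 0 < u -> u / (u - c) <= 1.
Proof.
move=> u0; rewrite ler_pdivrMr ?subr_gt0 ?min_xi_lt// mul1r lerBrDr gerDl.
by rewrite /c ge_min lexx orbT.
Qed.

Lemma wealth_min_xi_le u t : 0 < u -> 0 <= t -> wealth c u t <= wealth xi u t.
Proof. by move=> u0 t0; apply: wealth_le => //; rewrite /c ge_min lexx. Qed.

Lemma interior_admissible u s : 0 < u -> 0 < s < u / (u - c) -> admissible I a u s.
Proof.
move=> u0 /andP[s0 sT]; split.
  by rewrite (ltW s0) (le_trans (ltW sT) (sup_admissible_le1 u0)).
apply: lt_le_trans (wealth_min_xi_le u0 (ltW s0)).
by rewrite wealth_gt0E// min_xi_lt.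
Qed.

Lemma optimal_proportion_critical u t0 : 0 < u -> critical mu D a c u t0 ->
  optimal_proportion I F a u t0.
Proof.
move=> u0 crit; have cu := min_xi_lt u0.
have /andP[t00 t0T] := critical_ge0_le u0 cu crit.
split.
- by rewrite t00 (le_trans t0T (sup_admissible_le1 u0)).
- by apply: le_trans (wealth_min_xi_le u0 t00); rewrite wealth_ge0E.
- move=> t At; apply: (critical_optimal mD D1 a_meas min_xi_le u0 cu _ crit At).
  by move=> s; exact: admissible_sub.
Qed.

Lemma optimal_proportion_unique u t0 t : 0 < u -> critical mu D a c u t0 ->
  optimal_proportion I F a u t -> t = t0.
Proof.
move=> u0 crit [/andP[t_ge0 t_le1] wt opt]; have cu := min_xi_lt u0.
apply: (optimal_critical_unique mD D1 a_meas min_xi_le nc u0 cu _ _ crit _ opt).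
- by move=> s /(admissible_sub u0)[].
- by move=> s; exact: interior_admissible.
- rewrite t_ge0/= /c; have [xi0|xi0] := leP xi 0.
    by rewrite -wealth_ge0E// (le_lt_trans xi0).
  by rewrite subr0 divff// gt_eqF.
Qed.

Lemma t_bar_continuous_at u : 0 < u -> {for u, continuous (t_bar I F a)}.
Proof.
apply: (critical_continuous mD D1 a_meas min_xi_le nc); last exact: t_bar_critical.
by rewrite /c ge_min lexx orbT.
Qed.

End t_bar_optimal.

Theorem theorem5p1 (R : realType) (I : interval R)
    (F : cumulativeBounded (0 : R) (1 : R)) (a : R -> R)
    (F_on_I : is_distribution_on I F)
    (a_meas : measurable_fun [set` I] a)
    (a_lbound : has_lbound (a @` [set` I]))
    (xi_essinf : forall e : R, 0 < e ->
      (0 < lebesgue_stieltjes_measure F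
             [set x | x \in I /\ (a x < xi I a + e)%R])%E)
    (a_nonconst : exists2 d : R, 0 < d &
      (lebesgue_stieltjes_measure F
         [set x | x \in I /\ (a x < xi I a + d)%R] < 1)%E)
    (E_gt0 : (0 < expectation_a I F a)%E) :
  {within `]0, +oo[, continuous (t_bar I F a)} /\
  forall u : R, 0 < u ->
    optimal_proportion I F a u (t_bar I F a u) /\
    forall t : R, optimal_proportion I F a u t -> t = t_bar I F a u.
Proof.
have crit u : 0 < u ->
    critical (lebesgue_stieltjes_measure F) [set` I] a (Num.min (xi I a) 0) u (t_bar I F a u).
  exact: t_bar_critical.
split.
  rewrite continuous_open_subspace; last exact: interval_open.
  move=> u; rewrite inE/= in_itv/= andbT => u0.
  by apply: t_bar_continuous_at.
move=> u u0; split.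
  exact: (optimal_proportion_critical F_on_I a_meas a_lbound u0 (crit _ u0)).
move=> t; exact: (optimal_proportion_unique F_on_I a_meas a_lbound xi_essinf a_nonconst u0
  (crit _ u0)).
Qed.
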